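(* Let $\chi$ be a $k$-configuration for which there is an (independent) collection of $r\ge 2$ nonempty subsets $I_1,\ldots,I_r\subseteq[k]$ such that, for every $j\in\{1,\ldots,r\}$, $\chi\big(I_1\cup\cdots\cup\widehat{I_j}\cup\cdots\cup I_r\big)=0$, but $\chi(I_1\cup\cdots\cup I_r)=1$. Then $\chi$ is not realizable in $\mathbb{F}_n\times\mathbb{Z}^{r-2}$.
   Context: $\mathbb{F}_n$ is the free group of rank $n$ and $\mathbb{Z}^m$ the free-abelian group of rank $m$. For $k\ge 1$, $[k]=\{1,\ldots,k\}$ and $\mathcal{P}([k])$ is its power set. A $k$-configuration is a map $\chi\colon\mathcal{P}([k])\setminus\{\varnothing\}\to\{0,1\}$. Subgroups $H_1,\ldots,H_k$ (possibly with repetitions) of a group $G$ realize $\chi$ if, for every nonempty $I\subseteq[k]$, the intersection $\bigcap_{i\in I}H_i$ is finitely generated when $\chi(I)=0$ and not finitely generated when $\chi(I)=1$. The configuration $\chi$ is realizable in $G$ if some $k$ subgroups of $G$ realize it. A hat over a term means that the term is omitted. A collection $\{I_1,\ldots,I_r\}$ of $r$ subsets of $[k]$ is independent if, for all $S,T\subseteq\{1,\ldots,r\}$, $\bigcup_{s\in S}I_s=\bigcup_{t\in T}I_t$ implies $S=T$ (the empty union being $\varnothing$). Independence of the collection is parenthetical: it is implied by the stated conditions on $\chi$. *)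

(* Defs.v *)
From HB Require Import structures.
From mathcomp Require Import all_boot all_algebra.
From mathcomp Require Import boolp classical_sets cardinality.

Set Implicit Arguments.
Unset Strict Implicit.
Unset Printing Implicit Defensive.

Local Open Scope group_scope.

(* (i, false) stands for the i-th basis element x_i, (i, true) for its inverse. *)
Notation letter n := ('I_n * bool)%type.

Definition inv_letter n (a : letter n) : letter n := (a.1, ~~ a.2).

Definition reduced n (w : seq (letter n)) : bool :=
  sorted (fun a b => b != inv_letter a) w.

Record free_group (n : nat) : Type :=
  FreeGroup { word : seq (letter n); word_reduced : reduced word }.

HB.instance Definition _ n := [isSub for @word n].
HB.instance Definition _ n := [Choice of free_group n by <:].

(* Left multiplication of a reduced word by a letter, with cancellation. *)
Definition push n (a : letter n) (w : seq (letter n)) : seq (letter n) :=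
  if w is b :: w' then if b == inv_letter a then w' else a :: w else [:: a].

Section FreeGroupLaws.
Variable n : nat.
Implicit Types (a b : letter n) (u v w : seq (letter n)).

Lemma inv_letterK : involutive (@inv_letter n).
Proof. by case=> i b; rewrite /inv_letter /= negbK. Qed.

Lemma push_reduced a w : reduced w -> reduced (push a w).
Proof.
case: w => [|b w] //= rw; case: ifPn => [_|ba /=]; last by rewrite ba.
exact: path_sorted rw.
Qed.

Lemma foldr_push_reduced u v : reduced v -> reduced (foldr (@push n) v u).
Proof. by move=> rv; elim: u => //= a u; exact: push_reduced. Qed.

Lemma foldr_push_id w : reduced w -> foldr (@push n) [::] w = w.
Proof.
elim: w => [|a [|b w] IHw] // rw.
rewrite /= in IHw; rewrite /= IHw; last exact: path_sorted rw.
by case/andP: rw => /negPf ba _; rewrite /push ba.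
Qed.

Lemma push_invK a w : reduced w -> push a (push (inv_letter a) w) = w.
Proof.
case: w => [|b w] /= => [_|]; first by rewrite eqxx.
rewrite inv_letterK; case: eqP => [->|_] rw; last by rewrite /= eqxx.
by case: w rw => [|c w] //= /andP[/negPf ca _]; rewrite ca.
Qed.

Lemma foldr_push_push a w v : reduced v ->
  foldr (@push n) v (push a w) = push a (foldr (@push n) v w).
Proof.
case: w => [|b w] //= rv; case: eqP => [->|//].
by rewrite push_invK // foldr_push_reduced.
Qed.

Lemma foldr_pushA u v w : reduced w ->
  foldr (@push n) (foldr (@push n) w v) u =
  foldr (@push n) w (foldr (@push n) v u).
Proof.
by move=> rw; elim: u => //= a u ->; rewrite foldr_push_push.
Qed.

Lemma foldr_push_inv w v : reduced v ->
  foldr (@push n) (foldr (@push n) v (rev (map (@inv_letter n) w))) w = v.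
Proof.
elim: w v => [|b w IHw] v rv //=.
by rewrite rev_cons foldr_rcons IHw ?push_invK // push_reduced.
Qed.

Lemma inv_word_reduced w : reduced w -> reduced (rev (map (@inv_letter n) w)).
Proof.
rewrite /reduced rev_sorted sorted_map; apply: sub_sorted => a b /=.
by rewrite inv_letterK; apply: contraNneq => ->.
Qed.

Definition free_one : free_group n := @FreeGroup n [::] isT.

Definition free_mul (x y : free_group n) : free_group n :=
  FreeGroup (foldr_push_reduced (word x) (word_reduced y)).

Definition free_inv (x : free_group n) : free_group n :=
  FreeGroup (inv_word_reduced (word_reduced x)).

Lemma free_mulA : associative free_mul.
Proof.
by move=> x y z; apply: val_inj; rewrite /= foldr_pushA // word_reduced.
Qed.

Lemma free_mul1 : left_id free_one free_mul.
Proof. by move=> x; apply: val_inj. Qed.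

Lemma free_mulr1 : right_id free_one free_mul.
Proof. by move=> x; apply: val_inj; rewrite /= foldr_push_id ?word_reduced. Qed.

Lemma free_invK : involutive free_inv.
Proof.
move=> x; apply: val_inj; rewrite /= map_rev revK -map_comp.
by rewrite map_id_in // => a _ /=; rewrite inv_letterK.
Qed.

Lemma free_mulV : right_inverse free_one free_inv free_mul.
Proof.
move=> x; apply: val_inj => /=.
rewrite -[X in foldr _ X]foldr_push_id ?inv_word_reduced ?word_reduced //.
exact: foldr_push_inv.
Qed.

Lemma free_mulVl : left_inverse free_one free_inv free_mul.
Proof. by move=> x; rewrite -[X in free_mul _ X]free_invK free_mulV. Qed.

End FreeGroupLaws.

HB.instance Definition _ n := isGroup.Build (free_group n)
  (@free_mulA n) (@free_mul1 n) (@free_mulr1 n) (@free_mulVl n) (@free_mulV n).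

Definition free_abelian_group (m : nat) : groupType :=
  Algebra.to_multiplicative 'rV[int]_m.

Definition is_subgroup (G : groupType) (H : set G) : Prop :=
  [/\ H 1, forall x y, H x -> H y -> H (x * y) & forall x, H x -> H x^-1].

Definition generated (G : groupType) (X : set G) : set G :=
  smallest (@is_subgroup G) X.

Definition finitely_generated (G : groupType) (H : set G) : Prop :=
  exists2 X : set G, finite_set X & H = generated X.

Definition nonempty_set (k : nat) : Type := {I : {set 'I_k} | I != finset.set0}.

(* The value 0 is [false], the value 1 is [true]. *)
Definition configuration (k : nat) : Type := nonempty_set k -> bool.

Definition realize (G : groupType) (k : nat) (chi : configuration k)
    (H : 'I_k -> set G) : Prop :=
  forall I : nonempty_set k,
    (chi I = false ->
       finitely_generated (\bigcap_(i in [set` val I]) H i)%classic) /\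
    (chi I = true ->
       ~ finitely_generated (\bigcap_(i in [set` val I]) H i)%classic).

Definition realizable (G : groupType) (k : nat) (chi : configuration k) : Prop :=
  exists H : 'I_k -> set G, (forall i, is_subgroup (H i)) /\ realize chi H.

Lemma bigcup_neq0 r k (I : 'I_r -> nonempty_set k) (J : nonempty_set r) :
  (\bigcup_(i in val J) val (I i) != finset.set0)%SET.
Proof.
case: J => J /= /set0Pn[j jJ]; have /set0Pn[x xIj] := valP (I j).
by apply/set0Pn; exists x; apply/finset.bigcupP; exists j.
Qed.

Definition union_over r k (I : 'I_r -> nonempty_set k) (J : nonempty_set r) :
    nonempty_set k :=
  exist _ (\bigcup_(i in val J) val (I i))%SET (bigcup_neq0 I J).

Lemma indices_neq0 r : 1 < r -> ([set: 'I_r] != finset.set0)%SET.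
Proof. by move=> r1; rewrite -card_gt0 cardsT card_ord ltnW. Qed.

Lemma indices_but_neq0 r (j : 'I_r) : 1 < r -> ([set~ j] != finset.set0)%SET.
Proof. by move=> r1; rewrite -card_gt0 cardsC1 card_ord; case: r r1 j => [|[]]. Qed.

Definition indices r (hr : 1 < r) : nonempty_set r :=
  exist _ [set: 'I_r]%SET (indices_neq0 hr).

Definition indices_but r (hr : 1 < r) (j : 'I_r) : nonempty_set r :=
  exist _ [set~ j]%SET (indices_but_neq0 j hr).

Definition independent r k (I : 'I_r -> nonempty_set k) : Prop :=
  forall S T : {set 'I_r},
    (\bigcup_(s in S) val (I s) = \bigcup_(t in T) val (I t))%SET -> S = T.

(* The values imposed on [chi] force the family to be independent, and hence
   injective, so that neither condition has to be assumed. *)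
Lemma configuration_independent r k (hr : 1 < r) (chi : configuration k)
    (I : 'I_r -> nonempty_set k) :
  (forall j, chi (union_over I (indices_but hr j)) = false) ->
  chi (union_over I (indices hr)) = true ->
  independent I.
Proof.
move=> chi0 chi1.
suff sub (S T : {set 'I_r}) :
    (\bigcup_(s in S) val (I s) = \bigcup_(t in T) val (I t))%SET -> S \subset T.
  by move=> S T E; apply/eqP; rewrite finset.eqEsubset !sub.
move=> E; apply/fintype.subsetP => s sS; apply: contraT => sT.
have := chi0 s; suff -> : union_over I (indices_but hr s) = union_over I (indices hr).
  by rewrite chi1.
apply/val_inj/eqP; rewrite /= finset.eqEsubset; apply/andP; split.
  by apply/bigcupsP => i _; apply: (finset.bigcup_sup i); rewrite ?inE.
apply/bigcupsP => i _; have [->|/negPf si] := eqVneq i s; last first.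
  by apply: (finset.bigcup_sup i); rewrite ?inE ?si.
apply: (@fintype.subset_trans _ _ (\bigcup_(t in T) val (I t))%SET).
  by rewrite -E; apply: (finset.bigcup_sup s).
apply/bigcupsP => t tT; apply: (finset.bigcup_sup t); rewrite ?inE //.
by apply: contraNneq sT => <-.
Qed.

(* Main.v *)
Require Import Defs.
From HB Require Import structures.
From mathcomp Require Import all_boot all_algebra.
From mathcomp Require Import boolp classical_sets cardinality.

(** Let [m = r - 2], let [K l] be the intersection of the subgroups indexed by
    [I l], let [N j] be the intersection of the [K l] with [l != j], and let
    [M] be the intersection of all the [K l].  The claim is that [M] is finitely
    generated as soon as every [N j] is ([fg_bigcap]).

    A subgroup of [F_n * Z^m] is finitely generated if and only if its
    projection to [F_n] is: the kernel of the projection is a subgroup of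
    [Z^m], hence finitely generated ([fg_image], [fg_of_projection]).  Write
    [P] for the intersection of the projections of the [N j] and [Q] for the
    projection of [M], so that [Q] is contained in [P].  By Howson's theorem
    ([finite_coreI]) [P] is finitely generated, and it remains to see that [Q]
    has finite index in [P].

    An element [w] of [P] has lifts [(w, a j)] in [N j], one for each [j].
    Commutators of such lifts have trivial second component, so that [Q]
    contains the commutators of [P] and [P] is abelian modulo [Q].  Moreover
    [a] consists of [r = m + 2] points of [Z^m], so Radon's theorem ([radon])
    gives a positive multiple [e] of a point common to the convex hulls of two
    disjoint parts of this family, integrally: [\sum_j p j = \sum_j q j = e],
    [\sum_j p j * a j = \sum_j q j * a j] with [p] and [q] of disjoint
    supports.  Since [(w, a j)] is in [K l] for [l != j], the element
    [(w ^ e, \sum_j p j * a j)] is in [K l] when [p l = 0], and, seen as a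
    combination with coefficients [q], also when [q l = 0]: it is in [M].
    Hence every element of [P] has a positive power in [Q].  The quotient of
    [P] by [Q] is a finitely generated abelian torsion group, so it is finite
    ([finite_index_torsion]).

    In a free group both Howson's theorem and the finite generation of
    subgroups of finite index are read off from one criterion: a subgroup is
    finitely generated if and only if the initial segments of its reduced words
    lie in finitely many of its cosets ([fg_finite_core], [finite_core_fg]). *)

Set Implicit Arguments.
Unset Strict Implicit.
Unset Printing Implicit Defensive.

Local Open Scope classical_set_scope.
Local Open Scope group_scope.

(** * Subgroups and generators *)

Section Subgroups.
Variable G : groupType.
Implicit Types (H K X Y : set G) (x y : G).

Lemma is_subgroup1 H : is_subgroup H -> H 1.
Proof. by case. Qed.

Lemma is_subgroupM H : is_subgroup H -> forall x y, H x -> H y -> H (x * y).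
Proof. by case. Qed.

Lemma is_subgroupV H : is_subgroup H -> forall x, H x -> H x^-1.
Proof. by case. Qed.

Lemma is_subgroupX H : is_subgroup H -> forall x i, H x -> H (x ^+ i).
Proof.
move=> sH x i Hx; elim: i => [|i IHi]; first exact: is_subgroup1 sH.
by rewrite expgS; apply: is_subgroupM sH _ _ Hx IHi.
Qed.

Lemma is_subgroup_bigcap (T : Type) (D : set T) (H : T -> set G) :
  (forall i, D i -> is_subgroup (H i)) -> is_subgroup (\bigcap_(i in D) H i).
Proof.
move=> sH; split=> [i Di|x y Hx Hy i Di|x Hx i Di].
- exact: is_subgroup1 (sH i Di).
- exact: is_subgroupM (sH i Di) _ _ (Hx i Di) (Hy i Di).
- exact: is_subgroupV (sH i Di) _ (Hx i Di).
Qed.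

Lemma is_subgroupI H K : is_subgroup H -> is_subgroup K -> is_subgroup (H `&` K).
Proof.
move=> sH sK; split=> [|x y [Hx Kx] [Hy Ky]|x [Hx Kx]].
- by split; apply: is_subgroup1.
- by split; apply: is_subgroupM.
- by split; apply: is_subgroupV.
Qed.

Lemma generated_subgroup X : is_subgroup (generated X).
Proof. by apply: is_subgroup_bigcap => H []. Qed.

Lemma generated_incl X x : X x -> generated X x.
Proof. by move=> Xx H [_]; apply. Qed.

Lemma generated_min X H : is_subgroup H -> X `<=` H -> generated X `<=` H.
Proof. exact: smallest_sub. Qed.

Lemma finitely_generatedP H X : is_subgroup H -> finite_set X -> X `<=` H ->
  H `<=` generated X -> finitely_generated H.
Proof.
by move=> sH fX XH HX; exists X => //; apply/seteqP; split=> //; apply: generated_min.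
Qed.

Lemma is_subgroup_fg H : finitely_generated H -> is_subgroup H.
Proof. by case=> X _ ->; apply: generated_subgroup. Qed.

End Subgroups.

Section Morphisms.
Variables (G G' : groupType) (f : G -> G').
Hypothesis fM : {morph f : x y / x * y}.
Implicit Types (H : set G).

Lemma morph1 : f 1 = 1.
Proof. by apply: (mulgI (f 1)); rewrite -fM !mulg1. Qed.

Lemma morphV x : f x^-1 = (f x)^-1.
Proof. by apply: (mulgI (f x)); rewrite -fM !mulgV morph1. Qed.

Lemma is_subgroup_image H : is_subgroup H -> is_subgroup (f @` H).
Proof.
move=> sH; split=> [|_ _ [x Hx <-] [y Hy <-]|_ [x Hx <-]].
- by exists 1; [exact: is_subgroup1|exact: morph1].
- by exists (x * y); [exact: is_subgroupM|exact: fM].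
- by exists x^-1; [exact: is_subgroupV|exact: morphV].
Qed.

Lemma is_subgroup_preimage (H : set G') :
  is_subgroup H -> is_subgroup (f @^-1` H).
Proof.
move=> sH; split=> [|x y Hx Hy|x Hx]; rewrite /= ?morph1 ?fM ?morphV.
- exact: is_subgroup1.
- exact: is_subgroupM.
- exact: is_subgroupV.
Qed.

Lemma is_subgroup_kernel : is_subgroup [set x | f x = 1].
Proof.
split=> [|x y fx fy|x fx]; rewrite /= ?morph1 ?fM ?morphV //.
  by rewrite fx fy mulg1.
by rewrite fx invg1.
Qed.

Lemma fg_image H : finitely_generated H -> finitely_generated (f @` H).
Proof.
move=> /[dup] /is_subgroup_fg sH [X fX HX].
apply: (finitely_generatedP (X := f @` X)).
- exact: is_subgroup_image.
- exact: finite_image.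
- by move=> _ [x Xx <-]; exists x => //; rewrite HX; apply: generated_incl.
move=> _ [x + <-]; rewrite HX; move: x.
apply: (generated_min (H := f @^-1` generated (f @` X))).
  by apply: is_subgroup_preimage; apply: generated_subgroup.
by move=> x Xx; apply: generated_incl; exists x.
Qed.

(** Lifts of generators of the image together with generators of the kernel
    generate: an element agrees with a product of lifts up to the kernel. *)
Lemma fg_extension H : is_subgroup H -> finitely_generated (f @` H) ->
  finitely_generated (H `&` [set x | f x = 1]) -> finitely_generated H.
Proof.
move=> sH [Y fY HY] [Z fZ HZ].
have YH y : exists x, Y y -> H x /\ f x = y.
  have [Yy|?] := pselect (Y y); last by exists 1.
  have : generated Y y by apply: generated_incl.
  by rewrite -HY => -[x Hx <-]; exists x.
have [s sP] := choice YH.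
have ZH : Z `<=` H.
  move=> z Zz; suff [] : (H `&` [set x | f x = 1]) z by [].
  by rewrite HZ; apply: generated_incl.
apply: (finitely_generatedP (X := s @` Y `|` Z)) => //.
- by rewrite finite_setU; split=> //; apply: finite_image.
- by move=> x [[y Yy <-]|/ZH//]; case: (sP y Yy).
move=> h Hh; set X := _ `|` _.
have sX := generated_subgroup X.
have XH : generated X `<=` H.
  apply: generated_min => // x [[y Yy <-]|/ZH//]; by case: (sP y Yy).
have [g Xg fg] : (f @` generated X) (f h).
  have : generated Y (f h) by rewrite -HY; exists h.
  apply: (generated_min (H := f @` generated X)); first exact: is_subgroup_image.
  move=> y Yy; exists (s y); last by case: (sP y Yy).
  by apply: generated_incl; left; exists y.
have : (H `&` [set x | f x = 1]) (h * g^-1).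
  split; first by apply: is_subgroupM => //; apply: is_subgroupV => //; apply: XH.
  by rewrite /= fM morphV fg mulgV.
rewrite HZ => Zhg; rewrite -(mulgVK g h); apply: (is_subgroupM sX) => //.
move: Zhg; apply: (generated_min sX) => z Zz.
by apply: generated_incl; right.
Qed.

End Morphisms.

(** * Finitely generated subgroups of free groups *)

Section FreeGroup.
Variable n : nat.
Implicit Types (u v w : seq (letter n)) (x y p q : free_group n) (a : letter n).
Implicit Types (H K P Q T : set (free_group n)).

Lemma foldr_push_cat u v : reduced (u ++ v) -> foldr (@push n) v u = u ++ v.
Proof.
move=> ruv; rewrite -[RHS]foldr_push_id // foldr_cat foldr_push_id //.
by have [] := cat_sorted2 ruv.
Qed.

Definition initial p x : bool := prefix (word p) (word x).

Lemma initial_refl x : initial x x.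
Proof. exact: prefix_refl. Qed.

(** The word of a product is obtained by pushing the letters of [u] one by one
    onto [v]; as [u] is reduced, cancellation stops for good once a letter of
    [u] survives. *)
Lemma prefix_foldr_push u v w : reduced u -> reduced v ->
  prefix w (foldr (@push n) v u) ->
  prefix w u \/ exists2 w', prefix w' v & w = foldr (@push n) w' u.
Proof.
elim: u w => [|a u IHu] w /= ru rv; first by right; exists w.
have ru' : reduced u := path_sorted ru.
have IH w' := IHu w' ru' rv.
rewrite {1}/push; case uv: (foldr _ _ _) IH => [|b t] IH; last case: eqP => [ba|ba].
- case: w => [|c w]; first by left.
  by move=> /= cw; left; case/andP: cw => -> ; case: w => //= _; exact: prefix0s.
- move=> wt; have /IH[] : prefix (b :: w) (b :: t) by rewrite prefix_cons eqxx.
    by case: (u) ru => [|c u'] //= /andP[ca _] /andP[/eqP bc _];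
      rewrite -bc ba eqxx in ca.
  by case=> w' w'v bw; right; exists w' => //; rewrite -bw ba /push eqxx.
case: w => [|c w]; first by left.
move=> /andP[/eqP-> wbt]; have [wu|[w' w'v wE]] := IH w wbt.
  by left; rewrite /= eqxx.
right; exists w' => //; rewrite -wE; case: (w) wbt => [|d w0] //=.
by case/andP => /eqP->; case: eqP.
Qed.

Lemma initialM p x y : initial p (x * y) ->
  initial p x \/ exists2 q, initial q y & p = x * q.
Proof.
case/(prefix_foldr_push (word_reduced x) (word_reduced y)); first by left.
case=> w wy pE; right.
exists (FreeGroup (prefix_sorted wy (word_reduced y))) => //.
exact: val_inj.
Qed.

(** Walking along [x] backwards meets the same vertices as walking forwards. *)
Lemma initialV p x : initial p x^-1 -> exists2 q, initial q x & p = x^-1 * q.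
Proof.
case/prefixP=> w wE.
have rw : reduced w by have := word_reduced x^-1; rewrite wE => /cat_sorted2[].
pose c := FreeGroup rw.
have xE : x^-1 = p * c.
  by apply: val_inj; rewrite /= foldr_push_cat -?wE //; exact: word_reduced (x^-1).
exists c^-1; last by rewrite xE mulgK.
apply/prefixP; exists (word p^-1).
have -> : word x = rev (map (@inv_letter n) (word x^-1)) by rewrite -[in LHS](invgK x).
by rewrite wE map_cat rev_cat.
Qed.

(** The core of the coset graph of [H] is spanned by the closed paths at the
    base point spelled by the reduced words of [H]; its vertices are the cosets
    [H p] met here, and [T] contains representatives of them. *)
Definition finite_core H : Prop :=
  exists2 T : set (free_group n), finite_set T &
    forall h p, H h -> initial p h -> exists2 t : free_group n, T t & H (p * t^-1).

Lemma finite_initial x : finite_set [set p | initial p x].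
Proof.
pose f i := FreeGroup (take_sorted i (word_reduced x)).
apply: (sub_finite_set (B := f @` `I_(size (word x)).+1)).
  move=> p px; exists (size (word p)).
    by rewrite /= ltnS; case/prefixP: (px) => w ->; rewrite size_cat leq_addr.
  by apply: val_inj; apply/eqP; rewrite -prefixE.
exact: finite_image.
Qed.

(** The elements all of whose initial segments lie in the cosets of initial
    segments of generators form a subgroup: an initial segment of [x * y] or of
    [x^-1] is, up to a left factor in the subgroup, one of [x] or of [y]. *)
Lemma fg_finite_core H : finitely_generated H -> finite_core H.
Proof.
case=> X fX ->.
exists ([set 1] `|` \bigcup_(x in X) [set p | initial p x]).
  rewrite finite_setU; split=> //; apply: bigcup_finite => // x _.
  exact: finite_initial.
set T := _ `|` _; set K := generated X; have sK : is_subgroup K := generated_subgroup X.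
pose S := [set h | K h /\ forall p, initial p h -> exists2 t, T t & K (p * t^-1)].
suff KS : K `<=` S by move=> h p /KS[_]; apply.
apply: generated_min => [|x Xx]; last first.
  split=> [|p px]; first exact: generated_incl.
  by exists p; [right; exists x|rewrite mulgV; apply: (is_subgroup1 sK)].
split=> [|x y [Kx Sx] [Ky Sy]|x [Kx Sx]].
- split=> [|p]; first exact: (is_subgroup1 sK).
  rewrite /initial prefixs0 => /eqP p1; have -> : p = 1 by apply: val_inj.
  by exists 1; [left|rewrite mulgV; apply: (is_subgroup1 sK)].
- split=> [|p]; first exact: (is_subgroupM sK).
  case/initialM => [/Sx//|[q /Sy[t Tt Kqt] ->]]; exists t => //.
  by rewrite -mulgA; apply: (is_subgroupM sK).
- split=> [|_ /initialV[q /Sx[t Tt Kqt] ->]]; first exact: (is_subgroupV sK).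
  exists t => //; rewrite -mulgA.
  by apply: (is_subgroupM sK) => //; apply: (is_subgroupV sK).
Qed.

Definition of_letter a : free_group n := @FreeGroup n [:: a] isT.

(** The generators are the edges of the core, closed up to loops at the base
    point by the representatives [T]; adding the unit to the letters makes
    the representatives of the base point itself harmless. *)
Lemma finite_core_fg H : is_subgroup H -> finite_core H -> finitely_generated H.
Proof.
move=> sH [T0 fT0 HT0]; pose T : set (free_group n) := [set 1] `|` T0.
pose A : set (free_group n) := [set 1] `|` range of_letter.
have fT : finite_set T by rewrite finite_setU; split.
have fA : finite_set A by rewrite finite_setU; split=> //; apply: finite_image.
pose E : set (free_group n) := [set x.1.1 * x.1.2 * x.2^-1 | x in T `*` A `*` T].
have fE : finite_set E by apply: finite_image; do 2?apply: finite_setX.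
have gen t e s : T t -> A e -> T s -> H (t * e * s^-1) ->
    generated (E `&` H) (t * e * s^-1).
  by move=> Tt Ae Ts Htes; apply: generated_incl; split=> //; exists (t, e, s).
apply: (finitely_generatedP (X := E `&` H)) => //.
- exact: finite_setIl.
move=> h Hh; have sE := generated_subgroup (E `&` H).
(* A word is read one letter at a time, each step crossing one edge. *)
suff main w p : word p = w -> initial p h ->
    forall t, T t -> H (p * t^-1) -> generated (E `&` H) (p * t^-1).
  by have := main _ h erefl (initial_refl h) 1; rewrite invg1 mulg1; apply=> //; left.
elim/last_ind: w p => [|w a IHw] p pE ph t Tt Hpt.
  have p1 : p = 1 by apply: val_inj.
  move: Hpt; have -> : p * t^-1 = 1 * 1 * t^-1 by rewrite p1 mulg1.
  by apply: gen => //; left.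
have rwa : reduced (rcons w a) by rewrite -pE; apply: word_reduced.
have rw : reduced w by apply: prefix_sorted rwa; apply: prefix_rcons.
pose q := FreeGroup rw.
have pq : p = q * of_letter a.
  by apply: val_inj; rewrite /= foldr_push_cat ?cats1.
have qh : initial q h.
  by apply: prefix_trans ph; rewrite pE; apply: prefix_rcons.
have [u T0u Hqu] := HT0 _ _ Hh qh.
have Tu : T u by right.
have ptE : p * t^-1 = (q * u^-1) * (u * of_letter a * t^-1).
  by rewrite pq !mulgA mulgVK.
rewrite ptE; apply: (is_subgroupM sE); first exact: IHw.
apply: gen => //; first by right; exists a.
rewrite (_ : _ * _ = (q * u^-1)^-1 * (p * t^-1)); last by rewrite ptE mulKg.
by apply: is_subgroupM => //; apply: is_subgroupV.
Qed.

(** Howson's theorem: a coset of [H `&` K] is the intersection of a coset of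
    [H] and a coset of [K]. *)
Lemma finite_coreI H K : is_subgroup H -> is_subgroup K ->
  finite_core H -> finite_core K -> finite_core (H `&` K).
Proof.
move=> sH sK [T fT HT] [U fU KU].
have quot L x y z : is_subgroup L -> L (x * z^-1) -> L (y * z^-1) -> L (x * y^-1).
  move=> sL Lx Ly; rewrite (_ : x * _ = (x * z^-1) * (y * z^-1)^-1).
    by apply: is_subgroupM => //; apply: is_subgroupV.
  by rewrite invgM invgK mulgA mulgVK.
(* If [H t] and [K u] meet, any common element represents the coset of
   [H `&` K] in which they meet. *)
have common tu : exists s, forall p, H (p * tu.1^-1) -> K (p * tu.2^-1) ->
    H (p * s^-1) /\ K (p * s^-1).
  have [[s [Hs Ks]]|no] := pselect (exists s, H (s * tu.1^-1) /\ K (s * tu.2^-1)).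
    by exists s => p Hp Kp; split; [apply: quot Hp Hs|apply: quot Kp Ks].
  by exists 1 => p Hp Kp; case: no; exists p.
have [s sP] := choice common.
exists (s @` (T `*` U)); first by apply: finite_image; apply: finite_setX.
move=> h p [Hh Kh] ph.
have [[t Tt Hpt] [u Uu Kpu]] := (HT _ _ Hh ph, KU _ _ Kh ph).
by exists (s (t, u)); [exists (t, u)|apply: sP].
Qed.

Lemma finite_coreT : finite_core setT.
Proof. by exists [set 1] => // *; exists 1. Qed.

Lemma finite_core_bigcap (J : finType) (H : J -> set (free_group n)) :
  (forall j, is_subgroup (H j)) -> (forall j, finite_core (H j)) ->
  finite_core [set x | forall j, H j x].
Proof.
move=> sH fH.
have sub (s : seq J) : is_subgroup [set x | forall j, j \in s -> H j x].
  split=> [j _|x y Hx Hy j js|x Hx j js].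
  - exact: is_subgroup1.
  - exact: is_subgroupM (sH j) _ _ (Hx j js) (Hy j js).
  - exact: is_subgroupV (sH j) _ (Hx j js).
suff fs (s : seq J) : finite_core [set x | forall j, j \in s -> H j x].
  rewrite (_ : mkset _ = [set x | forall j, j \in enum J -> H j x]) //.
  apply/seteqP; split=> x Hx j; first by move=> _; apply: Hx.
  by apply: Hx; rewrite mem_enum.
elim: s => [|i s IHs].
  rewrite (_ : mkset _ = setT); first exact: finite_coreT.
  by apply/seteqP; split.
rewrite (_ : mkset _ = H i `&` [set x | forall j, j \in s -> H j x]).
  exact: finite_coreI.
apply/seteqP; split=> x.
  by move=> Hx; split=> [|j js]; apply: Hx; rewrite inE ?eqxx ?js ?orbT.
by move=> [Hi Hs] j; rewrite inE => /predU1P[->|/Hs].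
Qed.

(** Each coset of [P] meeting the core splits into finitely many cosets of
    [Q]. *)
Lemma finite_core_finite_index P Q S : finite_set S -> Q `<=` P ->
  (forall x, P x -> exists2 s, S s & Q (x * s^-1)) ->
  finite_core P -> finite_core Q.
Proof.
move=> fS QP PS [T fT PT].
exists [set s * t | s in S & t in T]; first exact: finite_image2.
move=> h p /QP Ph ph; have [t Tt /PS[s Ss Q']] := PT _ _ Ph ph.
by exists (s * t); [exists s => //; exists t|rewrite invgM mulgA].
Qed.

End FreeGroup.

(** * Torsion abelian quotients *)

Section TorsionAbelianQuotient.
Variables (G : groupType) (P : set G).
Hypothesis sP : is_subgroup P.

Definition abelian_modulo (Q : set G) : Prop :=
  forall x y, P x -> P y -> Q (x * y * (y * x)^-1).

(** Adjoining to [Q] an element [x] with a power in [Q]: since products may be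
    reordered modulo [Q], the elements congruent to a power of [x] form a
    subgroup, and the exponent matters only modulo the order of [x]. *)
Lemma adjoin_torsion (Q : set G) x N : is_subgroup Q -> Q `<=` P ->
  abelian_modulo Q -> P x -> Q (x ^+ N.+1) ->
  exists Q', [/\ is_subgroup Q', Q `<=` Q' /\ Q' `<=` P, Q' x &
    forall g, Q' g -> exists2 e, e < N.+1 & Q (g * (x ^+ e)^-1)].
Proof.
move=> sQ QP abQ Px QxN.
have PM := is_subgroupM sP; have PV := is_subgroupV sP.
have PX := is_subgroupX sP; have QM := is_subgroupM sQ.
have QV := is_subgroupV sQ.
have conj g q : P g -> Q q -> Q (g * q * g^-1).
  move=> Pg Qq; rewrite (_ : _ * _ = g * q * (q * g)^-1 * q).
    by apply: QM => //; apply: abQ => //; apply: QP.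
  by rewrite invgM !mulgA mulgVK.
have QxX i : Q (x ^+ (N.+1 * i)).
  rewrite mulnC; elim: i => [|i IHi]; first exact: is_subgroup1.
  by rewrite mulSn expgnDr; apply: QM.
exists [set g | P g /\ exists e, Q (g * (x ^+ e)^-1)]; split.
- split=> [|g h [Pg [e Qg]] [Ph [f Qh]]|g [Pg [e Qg]]].
  + split; first exact: is_subgroup1.
    by exists 0; rewrite mulgV; apply: is_subgroup1.
  + split; first exact: PM.
    exists (e + f)%N; rewrite expgnDr.
    rewrite (_ : _ * _ = g * (h * (x ^+ f)^-1) * g^-1 * (g * (x ^+ e)^-1)).
      by apply: QM => //; apply: conj.
    by rewrite invgM !mulgA mulgVK.
  + split; first exact: PV.
    (* [x ^ (N * e)] is inverse to [x ^ e] modulo [Q], as [x ^ (N.+1 * e)] is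
       in [Q]. *)
    exists (N * e)%N.
    rewrite (_ : _ * _ = (x ^+ e)^-1 * (g * (x ^+ e)^-1)^-1 * ((x ^+ e)^-1)^-1 *
      (x ^+ (N.+1 * e))^-1).
      by apply: QM; [apply: conj; [apply/PV/PX|exact: QV]|apply/QV/QxX].
    by rewrite mulSn addnC expgnDr !invgM !invgK !mulgA mulVg mul1g mulgK.
- split=> [q Qq|g []//]; split; first exact: QP.
  by exists 0; rewrite invg1 mulg1.
- by split=> //; exists 1%N; rewrite mulgV; apply: is_subgroup1.
- move=> g [Pg [e Qg]]; exists (e %% N.+1)%N; first exact: ltn_pmod.
  rewrite (_ : _ * _ = g * (x ^+ e)^-1 * x ^+ (N.+1 * (e %/ N.+1))); first exact: QM.
  by rewrite {2}(divn_eq e N.+1) [(_ %/ _ * _)%N]mulnC expgnDr invgM mulgA mulgVK.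
Qed.

Lemma finite_index_torsion_seq (Q : set G) (s : seq G) :
  is_subgroup Q -> Q `<=` P -> abelian_modulo Q ->
  (forall x, x \in s -> P x /\ exists N, Q (x ^+ N.+1)) ->
  exists Q', [/\ is_subgroup Q', Q `<=` Q', [set` s] `<=` Q' &
    exists2 S : set G, finite_set S &
      forall g, Q' g -> exists2 t, S t & Q (g * t^-1)].
Proof.
elim: s Q => [|x s IHs] Q sQ QP abQ tors.
  exists Q; split=> //; exists [set 1] => // g Qg.
  by exists 1 => //; rewrite invg1 mulg1.
have [Px [N QxN]] := tors x (mem_head x s).
have [Q1 [sQ1 [QQ1 Q1P] Q1x red]] := adjoin_torsion sQ QP abQ Px QxN.
have abQ1 : abelian_modulo Q1 by move=> y z Py Pz; apply/QQ1/abQ.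
have [|Q2 [sQ2 Q12 sQ2' [S fS red2]]] := IHs Q1 sQ1 Q1P abQ1.
  move=> y ys; have [Py [M QyM]] : P y /\ exists M, Q (y ^+ M.+1).
    by apply: tors; rewrite inE ys orbT.
  by split=> //; exists M; apply: QQ1.
exists Q2; split=> //.
- by move=> y Qy; apply/Q12/QQ1.
- by move=> y /=; rewrite inE => /predU1P[->|/sQ2'//]; apply: Q12.
exists [set x ^+ e * t | e in `I_N.+1 & t in S]; first exact: finite_image2.
move=> g /red2[t St /red[e eN Qg]]; exists (x ^+ e * t).
  by exists e => //; exists t.
by rewrite invgM mulgA.
Qed.

(** Modulo [Q], the subgroup [P] is a finitely generated abelian torsion
    group, hence finite. *)
Lemma finite_index_torsion (Q : set G) : finitely_generated P ->
  is_subgroup Q -> Q `<=` P -> abelian_modulo Q ->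
  (forall x, P x -> exists N, Q (x ^+ N.+1)) ->
  exists2 S : set G, finite_set S & forall g, P g -> exists2 t, S t & Q (g * t^-1).
Proof.
move=> [X /finite_seqP[s ->] PE] sQ QP abQ tors.
have [|Q' [sQ' _ sQ'' [S fS red]]] := finite_index_torsion_seq (s := s) sQ QP abQ.
  move=> x xs; have Px : P x by rewrite PE; apply: generated_incl.
  by split=> //; apply: tors.
exists S => // g; rewrite PE => Pg; apply: red.
by move: Pg; apply: generated_min.
Qed.

End TorsionAbelianQuotient.

(** * Subgroups of free abelian groups *)

Section FreeAbelian.
Import GRing.Theory Num.Theory.
Local Open Scope ring_scope.

Let Zgroup : groupType := Algebra.to_multiplicative int.

Lemma is_subgroup_mulz (H : set Zgroup) : is_subgroup H ->
  forall (x : int) (k : int), H x -> H (k * x).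
Proof.
move=> sH x k Hx.
have HX i : H (i%:Z * x).
  by rewrite -natz mulr_natl; exact: (is_subgroupX sH i Hx).
case: k => i; first exact: HX.
by rewrite NegzE mulNr; apply: (is_subgroupV sH (HX _)).
Qed.

(** The least positive element, if any, is a generator, by Euclidean
    division. *)
Lemma fg_subgroup_int (H : set Zgroup) : is_subgroup H -> finitely_generated H.
Proof.
move=> sH; have [[d [d_gt0 Hd]]|nopos] := pselect (exists d : nat, (0 < d)%N /\ H d%:Z).
  have ex : exists d : nat, (0 < d)%N && `[< H d%:Z >].
    by exists d; apply/andP; split=> //; apply/asboolP.
  case: (ex_minnP ex) => {}e /andP[e_gt0 /asboolP He] e_min.
  apply: (@finitely_generatedP Zgroup H [set e%:Z]) => // [x ->//|x Hx].
  have sE := generated_subgroup (G := Zgroup) [set e%:Z].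
  have mod0 : (x %% e%:Z)%Z = 0.
    have : H (x %% e%:Z)%Z.
      have -> : (x %% e%:Z)%Z = x + - ((x %/ e%:Z)%Z * e%:Z).
        by rewrite {2}(divz_eq x e) addrAC subrr add0r.
      apply: (is_subgroupM sH) => //; apply: (is_subgroupV sH).
      exact: is_subgroup_mulz.
    have : (0 <= (x %% e%:Z)%Z < e%:Z) by rewrite modz_ge0 ?ltz_pmod // -lt0n.
    case: (x %% e%:Z)%Z => // -[//|i] /= lt_ie Hi.
    by have := e_min i.+1 (introT (asboolP _) Hi); rewrite leqNgt -ltz_nat lt_ie.
  rewrite (divz_eq x e) mod0 addr0; apply: (is_subgroup_mulz sE).
  exact: generated_incl.
apply: (@finitely_generatedP Zgroup H [set 1%g]) => // [x ->|x Hx].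
  exact: is_subgroup1.
suff -> : x = 1%g by apply: generated_incl.
by case: x Hx => [[|i]|i] Hx //; case: nopos; exists i.+1; split=> //;
  apply: (is_subgroupV sH Hx).
Qed.

(** Induction on the number of coordinates that may be nonzero: each
    coordinate has a cyclic image. *)
Lemma fg_subgroup_free_abelian m (H : set (free_abelian_group m)) :
  is_subgroup H -> finitely_generated H.
Proof.
suff main k (L : set (free_abelian_group m)) : is_subgroup L ->
    (forall v : 'rV[int]_m, L v -> forall j : 'I_m, (k <= j)%N -> v 0 j = 0) ->
    finitely_generated L.
  by move=> sH; apply: (main m) => // v _ j; rewrite leqNgt ltn_ord.
elim: k L => [|k IHk] L sL L0.
  apply: (@finitely_generatedP _ L [set 1%g]) => // [x ->|v Lv].
    exact: is_subgroup1.
  suff -> : v = 1%g by apply: generated_incl.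
  by apply/rowP => j; rewrite L0 // mxE.
have [km|mk] := ltnP k m; last first.
  by apply: IHk => // v Lv j kj; have := ltn_ord j; rewrite ltnNge (leq_trans mk).
pose f (v : free_abelian_group m) : Zgroup := (v : 'rV[int]_m) 0 (Ordinal km).
have fM : {morph f : v w / (v * w)%g} by move=> v w; rewrite /f mxE.
apply: (fg_extension fM sL); first exact: fg_subgroup_int (is_subgroup_image fM sL).
apply: IHk => [|v [Lv fv] j].
  exact: is_subgroupI (is_subgroup_kernel fM).
rewrite leq_eqVlt => /predU1P[kj|]; last exact: L0.
by rewrite -[RHS]fv; congr (_ _ _); apply: val_inj.
Qed.

End FreeAbelian.

(** * Radon's theorem over the integers *)

Section Radon.
Import GRing.Theory Num.Theory.
Local Open Scope ring_scope.

Lemma clear_denominators r (c : 'rV[rat]_r) : exists d : rat, d != 0 /\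
  exists z : 'I_r -> int, forall j, (z j)%:~R = d * c 0 j.
Proof.
exists (\prod_j (denq (c 0 j))%:~R); split.
  by apply/prodf_neq0 => j _; rewrite intr_eq0 denq_neq0.
exists (fun j => \prod_(i | i != j) denq (c 0 i) * numq (c 0 j)) => j.
by rewrite [in RHS](bigD1 j) //= mulrAC [_ * c 0 j]mulrC -numqE intrM rmorph_prod mulrC.
Qed.

(** The conditions form a homogeneous system of [m + 1] linear equations in
    [r > m + 1] unknowns: the matrix [A] has the points as rows, extended by a
    coordinate 1 that accounts for the condition on the sum. *)
Lemma integral_affine_dependence m r (a : 'I_r -> 'rV[int]_m) : (m.+1 < r)%N ->
  exists c : 'I_r -> int, [/\ exists j, c j != 0, \sum_j c j = 0 &
    \sum_j a j *~ c j = 0].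
Proof.
move=> m_lt_r.
pose A : 'M[rat]_(r, m + 1) := row_mx (\matrix_(j, i) (a j 0 i)%:~R) (const_mx 1).
have /rowV0Pn[c /sub_kermxP cA c_neq0] : kermx A != 0.
  rewrite -mxrank_eq0 mxrank_ker subn_eq0 -ltnNge.
  by apply: leq_ltn_trans (rank_leq_col A) _; rewrite addn1.
have [d [d_neq0 [z zE]]] := clear_denominators c.
have {cA} [ca c1] : c *m \matrix_(j, i) (a j 0 i)%:~R = 0 /\
    c *m (const_mx 1 : 'cV_r) = 0.
  by apply/eq_row_mx; rewrite row_mx0 -mul_mx_row.
exists z; split.
- have /rV0Pn[j cj] := c_neq0; exists j.
  by rewrite -(intr_eq0 rat) zE mulf_neq0.
- apply/eqP; rewrite -(intr_eq0 rat) rmorph_sum; apply/eqP.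
  under eq_bigr => j _ do rewrite /= zE.
  rewrite -mulr_sumr; move/rowP/(_ 0): c1; rewrite !mxE.
  by under eq_bigr => j _ do rewrite mxE mulr1; move=> ->; rewrite mulr0.
apply/rowP => i; apply/eqP; rewrite mxE -(intr_eq0 rat) summxE rmorph_sum; apply/eqP.
move/rowP/(_ i): ca; rewrite !mxE => ca.
transitivity (d * 0); last by rewrite mulr0.
rewrite -[in RHS]ca mulr_sumr.
apply: eq_bigr => j _; rewrite !mxE mulrA -zE -intrM mulrC.
by congr (_%:~R); rewrite -scaler_int mxE intz mulrC.
Qed.

(** Radon's theorem, with denominators cleared: an affine dependence is split
    into its positive part [p] and its negative part [q]. *)
Lemma radon m r (a : 'I_r -> 'rV[int]_m) : (m.+1 < r)%N ->
  exists p q : 'I_r -> nat, [/\ forall j, p j = 0%N \/ q j = 0%N,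
    (0 < \sum_j p j)%N, (\sum_j p j = \sum_j q j)%N &
    \sum_j a j *+ p j = \sum_j a j *+ q j].
Proof.
move=> /(integral_affine_dependence a)[c [[j0 cj0] c1 ca]].
pose p j : nat := if 0 <= c j then `|c j|%N else 0%N.
pose q j : nat := if 0 <= c j then 0%N else `|c j|%N.
have cE j : c j = (p j)%:Z - (q j)%:Z.
  by rewrite /p /q; case: (c j) => k /=; rewrite ?subr0 // sub0r NegzE.
have pq : (\sum_j p j = \sum_j q j)%N.
  apply/eqP; rewrite -eqz_nat -subr_eq0 !(big_morph Posz PoszD erefl) -sumrB -[eqbRHS]c1.
  by apply/eqP/eq_bigr => j _.
exists p, q; split=> //.
- by move=> j; rewrite /p /q; case: ifP; [right|left].
- rewrite lt0n; apply: contraNN cj0 => p0.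
  have q0 := p0; rewrite pq in q0; rewrite !sum_nat_eq0 in p0 q0.
  by rewrite cE (eqP (forallP p0 j0)) (eqP (forallP q0 j0)).
apply/eqP; rewrite -subr_eq0 -sumrB -[eqbRHS]ca; apply/eqP/eq_bigr => j _.
by rewrite cE mulrzBr.
Qed.

End Radon.

(** * Subgroups of the product of a free group and a free abelian group *)

Section Product.
Variables n m : nat.
Local Notation F := (free_group n).
Local Notation A := (free_abelian_group m).
Local Notation FA := (F * A)%type.
Implicit Types L M : set FA.

Let proj1 (x : FA) : F := x.1.
Let proj2 (x : FA) : A := x.2.

Let proj1M : {morph proj1 : x y / x * y}. Proof. by []. Qed.
Let proj2M : {morph proj2 : x y / x * y}. Proof. by []. Qed.

(** The kernel of the projection to the free factor embeds in the free abelian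
    factor. *)
Lemma fg_of_projection M : is_subgroup M ->
  finitely_generated (proj1 @` M) -> finitely_generated M.
Proof.
move=> sM fM; apply: (fg_extension proj1M) => //.
have sL : is_subgroup (M `&` [set x | proj1 x = 1]).
  exact: is_subgroupI (is_subgroup_kernel proj1M).
apply: (fg_extension proj2M) => //.
  exact/fg_subgroup_free_abelian/is_subgroup_image.
apply: (@finitely_generatedP _ _ [set 1]) => //.
- exact: is_subgroupI (is_subgroup_kernel proj2M).
- by move=> _ ->; split; [split=> //; apply: is_subgroup1|].
move=> [w a] [[_ /= w1] /= a1].
have -> : (w, a) = 1 by rewrite -[w]/(proj1 (w, a)) w1 -[a]/(proj2 (w, a)) a1.
exact: generated_incl.
Qed.

Lemma is_subgroup_combination L r (w : F) (a : 'I_r -> 'rV[int]_m) (p : 'I_r -> nat) :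
  is_subgroup L -> (forall j, p j <> 0%N -> L (w, a j : A)) ->
  L (w ^+ (\sum_j p j), (\sum_j a j *+ p j)%R : A).
Proof.
move=> sL La; elim/big_rec2: _ => [|j x e _ Lx]; first exact: is_subgroup1 sL.
have [->|pj] := eqVneq (p j) 0%N; first by rewrite GRing.mulr0n GRing.add0r.
have Lj := is_subgroupX sL (p j) (La j (elimN eqP pj)).
have powE i : ((w, a j : A) : FA) ^+ i = (w ^+ i, (a j *+ i)%R : A).
  by elim: i => // i IHi; rewrite !expgS IHi GRing.mulrS.
by have := is_subgroupM sL Lj Lx; rewrite expgnDr powE.
Qed.

(** For [m = 0] and [r = 2] this is Howson's theorem.  The bound on [r] is the
    one of Radon's theorem, applied to lifts of an element of the free factor. *)
Theorem fg_bigcap r (K : 'I_r -> set FA) : m.+1 < r ->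
  (forall l, is_subgroup (K l)) ->
  (forall j, finitely_generated [set x | forall l, l != j -> K l x]) ->
  finitely_generated [set x | forall l, K l x].
Proof.
move=> m_lt_r sK fgM.
set M := [set x | _]; pose N j := [set x | forall l, l != j -> K l x].
have sM : is_subgroup M.
  split=> [l|x y Mx My l|x Mx l].
  - exact: is_subgroup1 (sK l).
  - exact: is_subgroupM (sK l) _ _ (Mx l) (My l).
  - exact: is_subgroupV (sK l) _ (Mx l).
pose P := [set w | forall j, (proj1 @` N j) w].
pose Q := proj1 @` M.
have fgN j : finitely_generated (proj1 @` N j) by apply: fg_image => //; apply: fgM.
have sN j := is_subgroup_fg (fgN j).
have sQ : is_subgroup Q by apply: is_subgroup_image.
have sP : is_subgroup P.
  split=> [j|x y Px Py j|x Px j].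
  - exact: is_subgroup1 (sN j).
  - exact: is_subgroupM (sN j) _ _ (Px j) (Py j).
  - exact: is_subgroupV (sN j) _ (Px j).
have QP : Q `<=` P by move=> _ [x Mx <-] j; exists x => // l _; apply: Mx.
have coreP : finite_core P.
  by apply: finite_core_bigcap => // j; apply: fg_finite_core.
have lift w : P w -> exists a : 'I_r -> 'rV[int]_m,
    forall j l, l != j -> K l (w, a j : A).
  move=> Pw; suff /choice[a Ka] : forall j, exists b : 'rV[int]_m,
      forall l, l != j -> K l (w, b : A) by exists a.
  by move=> j; have [[w' b] Nb <-] := Pw j; exists b.
(* Two lifts in the same [N j] have a commutator with second component 1,
   whatever [j] is; an index [j] other than [l] gives a lift in [K l]. *)
have abQ : abelian_modulo P Q.
  move=> v w /lift[a Ka] /lift[b Kb].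
  exists (v * w * (w * v)^-1, 1) => // l.
  have [j lj] : exists j, l != j.
    have r1 : 1 < r by apply: leq_ltn_trans m_lt_r.
    have [l0|l0] := eqVneq (l : nat) 0%N.
      by exists (Ordinal r1); apply/eqP => /(congr1 val); rewrite /= l0.
    by exists (Ordinal (ltnW r1)).
  have [Kv Kw] := (Ka j l lj, Kb j l lj).
  have := is_subgroupM (sK l) (is_subgroupM (sK l) Kv Kw)
    (is_subgroupV (sK l) (is_subgroupM (sK l) Kw Kv)).
  congr (K l _); congr pair.
  change (a j + b j - (b j + a j) = 0)%R.
  by rewrite (GRing.addrC (b j)) GRing.subrr.
have torQ w : P w -> exists e, Q (w ^+ e.+1).
  move=> /lift[a Ka]; have [p [q [pq p_gt0 sum_pq comb_pq]]] := radon a m_lt_r.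
  exists (\sum_j p j).-1; rewrite prednK //.
  exists (w ^+ (\sum_j p j), (\sum_j a j *+ p j)%R : A) => // l.
  have comb (e : 'I_r -> nat) : e l = 0%N ->
      K l (w ^+ (\sum_j e j), (\sum_j a j *+ e j)%R : A).
    move=> el; apply: (is_subgroup_combination (sK l)) => j ej.
    by apply: Ka; apply/eqP => lj; rewrite -lj in ej.
  have [pl|ql] := pq l; first exact: comb.
  by rewrite sum_pq comb_pq; apply: comb.
have [S fS red] := finite_index_torsion sP (finite_core_fg sP coreP) sQ QP abQ torQ.
apply: fg_of_projection => //; apply: finite_core_fg => //.
exact: finite_core_finite_index fS QP red coreP.
Qed.

End Product.

Theorem proposition4p3 (k n r : nat) (hk : 1 <= k) (hr : 2 <= r)
    (chi : configuration k) (I : 'I_r -> nonempty_set k)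
    (chi_omit : forall j : 'I_r, chi (union_over I (indices_but hr j)) = false)
    (chi_all : chi (union_over I (indices hr)) = true) :
  ~ realizable (free_group n * free_abelian_group (r - 2))%type chi.
Proof.
case=> H [sH real].
pose K l := \bigcap_(i in [set` val (I l)]) H i.
have bigcapE (J : nonempty_set r) :
    \bigcap_(i in [set` val (union_over I J)]) H i =
    [set x | forall l, l \in val J -> K l x].
  apply/seteqP; split=> x Hx.
    by move=> l lJ i /= iI; apply: Hx; apply/finset.bigcupP; exists l.
  by move=> i /= /finset.bigcupP[l lJ iI]; apply: Hx lJ _ iI.
have [_ /(_ chi_all)] := real (union_over I (indices hr)); apply.
rewrite bigcapE (_ : mkset _ = [set x | forall l, K l x]); last first.
  apply/seteqP; split=> x Kx l; last by move=> _; apply: Kx.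
  by apply: Kx; rewrite inE.
apply: fg_bigcap => [|l|j].
- by rewrite -[X in _ < X](subnK hr) addn2.
- exact: is_subgroup_bigcap.
have [/(_ (chi_omit j)) + _] := real (union_over I (indices_but hr j)).
rewrite bigcapE; congr finitely_generated; apply/seteqP; split=> x Kx l lj.
  by apply: Kx; rewrite !inE.
by apply: Kx; move: lj; rewrite !inE.
Qed.
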